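(* Let $n, k \ge 3$ be integers, let $F(n,k)$ be the $(n,k)$-firecracker tree, and let $\varepsilon = 1$ if $n$ is odd and $\varepsilon = 0$ if $n$ is even. Then $$\mathrm{rn}(F(n,k)) = \frac{(n^2+\varepsilon)k}{2} + 5n - 3.$$
   Context: A $k$-star is a tree consisting of $k$ leaves and one further vertex adjacent to all of them. The $(n,k)$-firecracker tree $F(n,k)$ is obtained by taking a path with $n$ vertices (length $n-1$) and $n$ disjoint copies of a $(k-1)$-star, and identifying one leaf of the $i$-th copy with the $i$-th vertex of the path, for each $i$ (so distinct copies are attached to distinct path vertices). For a connected graph $G$, a radio labeling is a map $f: V(G) \to \{0,1,2,\ldots\}$ with $d(u,v) + |f(u)-f(v)| \ge \mathrm{diam}(G)+1$ for all distinct $u,v$; its span is $\max\{|f(u)-f(v)|\}$, and $\mathrm{rn}(G)$ is the minimum span over all radio labelings of $G$. *)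

(* Defs.v *)
From mathcomp Require Import all_boot all_order all_algebra.
From mathcomp Require Import boolp.
Set Implicit Arguments.
Unset Strict Implicit.
Unset Printing Implicit Defensive.

(* A finite graph is given by its adjacency relation e on a finType T of       *)
(* vertices.                                                                  *)
Section RadioLabeling.
Variables (T : finType) (e : rel T).

Definition has_walk (x y : T) (m : nat) : bool :=
  [exists p : m.-tuple T, path e x p && (last x p == y)].

(* The least number of edges of a walk from x to y. A shortest walk has fewer  *)
(* than #|T| edges, so searching below #|T| suffices; for x and y in different *)
(* components (excluded when the graph is connected) the value is #|T|.       *)
Definition gdist (x y : T) : nat := find (has_walk x y) (iota 0 #|T|).

Definition gdiam : nat := \max_(u : T) \max_(v : T) gdist u v.

(* `|m - n| on nat is the absolute difference, not truncated subtraction.      *)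
Definition radio_labeling (f : T -> nat) : Prop :=
  forall u v : T, u != v -> gdiam + 1 <= gdist u v + `|f u - f v|.

Definition label_span (f : T -> nat) : nat := \max_(u : T) \max_(v : T) `|f u - f v|.

Definition radio_span (s : nat) : Prop :=
  exists2 f : T -> nat, radio_labeling f & label_span f = s.

Lemma radio_span_exists : exists s, `[< radio_span s >].
Proof.
pose f (u : T) := (enum_rank u : nat) * (gdiam + 1).
exists (label_span f); apply/asboolP; exists f => // u v neq_uv.
apply: leq_trans (leq_addl _ _).
wlog lt_uv : u v neq_uv / enum_rank u < enum_rank v.
  move=> IH; have [|lt_vu|/ord_inj/enum_rank_inj eq_uv] :=
    ltngtP (enum_rank u) (enum_rank v); first exact: IH.
    by rewrite distnC; apply: IH; rewrite // eq_sym.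
  by rewrite eq_uv eqxx in neq_uv.
rewrite /f distnEr ?leq_mul2r ?(ltnW lt_uv) ?orbT //.
by rewrite -mulnBl leq_pmull // subn_gt0.
Qed.

Definition radio_number : nat := ex_minn radio_span_exists.

End RadioLabeling.

Definition path_adj (n : nat) : rel 'I_n :=
  fun i j => (i.+1 == j :> nat) || (j.+1 == i :> nat).

(* The m-star: ord0 is the centre, the m other vertices are the leaves.        *)
Definition star_adj (m : nat) : rel 'I_m.+1 :=
  fun x y => (x == ord0) != (y == ord0).

(* (i, x) is the vertex x of the i-th copy of the (k-1)-star, which has k      *)
(* vertices. The leaf ord_max of the i-th copy is the i-th vertex of the path  *)
(* (it is a leaf as soon as 2 <= k).                                          *)
Definition firecracker (n k : nat) : rel ('I_n * 'I_k.-1.+1) :=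
  fun u v =>
    (u.1 == v.1) && star_adj u.2 v.2
    || [&& u.2 == ord_max, v.2 == ord_max & path_adj u.1 v.1].

(* Main.v *)
Require Import Defs.
From mathcomp Require Import all_boot all_order all_algebra.
From mathcomp Require Import zify ring.
Set Implicit Arguments.
Unset Strict Implicit.
Unset Printing Implicit Defensive.

(* Let [L u] be the distance from [u] to the nearest weight centre: the middle *)
(* vertex of the path for odd [n], the two middle vertices for even [n]. The   *)
(* distance of two vertices is at most [L u + L v], plus 1 for even [n], so    *)
(* the labels of consecutive vertices in increasing order of label differ by   *)
(* at least [D - L u - L v] with [D = n + 3 + odd n]; summing over all         *)
(* vertices bounds the span below in terms of the total weight, plus the       *)
(* levels of the first and last vertices, whose sum is at least [odd n].       *)
(* The bound is attained by an ordering that tours the copies cyclically,      *)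
(* alternating sides, so that all these inequalities are equalities. The       *)
(* remaining radio inequalities involve vertices 2 or 3 steps apart, because   *)
(* four consecutive gaps already add up to the diameter.                      *)

(** Summing the n * k - 1 consecutive gaps subtracts every level twice, except that the two end
    vertices are subtracted once; this telescoping is [radio_span_lower_bound], and [sum_lev] and
    [sum_depth] evaluate the total weight. For the converse, [link] describes the admissible steps
    of a tour, and [window1] to [window4] give the radio inequality along any linked sequence
    ([linked_ordering_radio]). It remains to enumerate all vertices by links with ends of least
    level: [even_seq] and [odd_seq]. *)

Section GraphDistance.
Variables (T : finType) (e : rel T).

Lemma gdist_le_walk x y m : has_walk e x y m -> gdist e x y <= m.
Proof.
move=> walk_m; rewrite /gdist; have [lt_m | le_m] := ltnP m #|T|.
  rewrite leqNgt; apply/negP => /(before_find 0).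
  by rewrite nth_iota // add0n walk_m.
by apply: leq_trans le_m; rewrite -[X in _ <= X](size_iota 0) find_size.
Qed.

Lemma has_walkS x w y m : e x w -> has_walk e w y m -> has_walk e x y m.+1.
Proof.
move=> exw /existsP[p /andP[wp yp]]; apply/existsP; exists [tuple of w :: p].
by rewrite /= exw wp.
Qed.

Lemma leq_gdist x y b :
  (forall p, path e x p -> last x p = y -> b <= size p) -> b <= #|T| ->
  b <= gdist e x y.
Proof.
move=> b_min b_le; rewrite /gdist; set s := iota _ _.
have [/(nth_find 0)|/hasNfind->] := boolP (has (has_walk e x y) s); last first.
  by rewrite size_iota.
have [lt_m|le_m _] := ltnP (find (has_walk e x y) s) #|T|; last first.
  exact: leq_trans le_m.
rewrite nth_iota // add0n => /existsP[p /andP[xp /eqP yp]].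
by rewrite -[X in _ <= X](size_tuple p) b_min.
Qed.

(** Since [d] drops by at most 1 along an edge, every walk is long enough; following edges along
    which it drops by exactly 1 gives a walk of that length. The bound by [#|T|] guards against the
    default value of [gdist]. *)
Lemma gdist_eq (d : T -> T -> nat) :
  (forall x, d x x = 0) -> (forall x y, d x y <= #|T|) ->
  (forall x w y, e x w -> d x y <= (d w y).+1) ->
  (forall x y, x != y -> exists2 w, e x w & (d w y).+1 = d x y) ->
  forall x y, gdist e x y = d x y.
Proof.
move=> d0 d_le dS d_desc x y; apply/eqP; rewrite eqn_leq; apply/andP; split.
  apply: gdist_le_walk; move: {2}(d x y) (erefl (d x y)) => m.
  elim: m x => [|m IHm] x def_m; have [<-|neq] := eqVneq x y.
  - rewrite d0; apply/existsP; exists [tuple]; exact/eqP.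
  - by have [w _] := d_desc x y neq; rewrite def_m.
  - by rewrite d0 in def_m *; apply/existsP; exists [tuple]; exact/eqP.
  - have [w exw] := d_desc x y neq; rewrite def_m => -[def_w].
    by apply: has_walkS exw _; rewrite -def_w IHm.
apply: leq_gdist => // p; elim: p x => [|w p IHp] x /= => [_ <-|].
  by rewrite d0.
by case/andP=> exw wp def_y; apply: leq_trans (dS _ w _ exw) _; rewrite ltnS IHp.
Qed.

End GraphDistance.

(** * Distances in the firecracker tree *)

(* The distance from the vertex [x] of a star copy to its path vertex [k.-1]. *)
Definition depth (k x : nat) : nat :=
  if x == k.-1 then 0 else if x == 0 then 1 else 2.

(* The distance between the vertices [x] of copy [i] and [y] of copy [j], on    *)
(* natural numbers so that arithmetic on copies is linear.                    *)
Definition fdist (k i x j y : nat) : nat :=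
  if i == j then
    if x == y then 0 else if (x == 0) || (y == 0) then 1 else 2
  else (i - j) + (j - i) + depth k x + depth k y.

Lemma depth_le2 k x : depth k x <= 2.
Proof. by rewrite /depth; do 2?case: ifP. Qed.

Lemma fdist_le k i x j y :
  fdist k i x j y <= (i - j) + (j - i) + depth k x + depth k y.
Proof.
rewrite /fdist; case: ifP => // /eqP->; rewrite /depth.
case: eqP => // neq_xy; case: (x =P 0) => [|_]; case: (y =P 0) => [|_] /=;
  case: (x =P k.-1); case: (y =P k.-1); lia.
Qed.

Lemma fdist_le_diam n k i x j y :
  i < n -> j < n -> fdist k i x j y <= n + 3.
Proof.
move=> lt_i lt_j; apply: leq_trans (fdist_le _ _ _ _ _) _.
by have := depth_le2 k x; have := depth_le2 k y; lia.
Qed.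

Section FirecrackerDistance.
Variables n k : nat.
Hypotheses (hn : 3 <= n) (hk : 3 <= k).
Notation T := ('I_n * 'I_k.-1.+1)%type.

Lemma firecrackerE (u v : T) :
  firecracker u v =
    (u.1 == v.1 :> nat) && ((u.2 == 0 :> nat) != (v.2 == 0 :> nat))
    || [&& u.2 == k.-1 :> nat, v.2 == k.-1 :> nat
         & (u.1.+1 == v.1 :> nat) || (v.1.+1 == u.1 :> nat)].
Proof. by []. Qed.

Lemma card_firecracker : #|{: T}| = n * k.
Proof. by rewrite card_prod !card_ord prednK //; apply: leq_trans hk. Qed.

Lemma fdist_adj (u w v : T) :
  firecracker u w -> fdist k u.1 u.2 v.1 v.2 <= (fdist k w.1 w.2 v.1 v.2).+1.
Proof.
rewrite firecrackerE; case: u w v => [i x] [j y] [l z] /=.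
rewrite /fdist /depth.
move: (ltn_ord x) (ltn_ord y) (ltn_ord z).
move: (nat_of_ord i) (nat_of_ord j) (nat_of_ord l) => {}i {}j {}l.
move: (nat_of_ord x) (nat_of_ord y) (nat_of_ord z) => {}x {}y {}z.
move=> lt_x lt_y lt_z /orP[/andP[/eqP-> Hxy]|/and3P[/eqP-> /eqP-> Hij]].
  case: ifP => _; case: (x =P 0) Hxy => //; case: (y =P 0) => //;
  case: (z =P 0); case: (x =P k.-1); case: (y =P k.-1); case: (z =P k.-1);
  rewrite /=; repeat (case: ifP); lia.
case: (i =P l); case: (j =P l); case: (z =P 0); case: (z =P k.-1);
  rewrite /= ?eqxx; repeat (case: ifP); lia.
Qed.

Lemma fdist_desc (u v : T) : u != v ->
  exists2 w : T, firecracker u w &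
    (fdist k w.1 w.2 v.1 v.2).+1 = fdist k u.1 u.2 v.1 v.2.
Proof.
case: u v => [i x] [j y]; rewrite xpair_eqE negb_and => neq.
have lt_x := ltn_ord x; have lt_y := ltn_ord y.
have [x0|x_gt0] := posnP x.
  have [eq_ij|neq_ij] := eqVneq i j.
    have neq_xy: x != y by move: neq; rewrite eq_ij eqxx.
    exists (j, y); rewrite ?firecrackerE /= /fdist eq_ij eqxx.
      by move: neq_xy; rewrite -val_eqE /= x0; case: (y : nat).
    by move: neq_xy; rewrite -val_eqE /= x0 !eqxx => /negPf->.
  exists (i, ord_max); rewrite ?firecrackerE /= /fdist ?x0 ?eqxx; first by lia.
  have /negPf-> : i != j :> nat by [].
  by rewrite /depth; repeat case: ifP; lia.
have [eq_x|neq_x] := eqVneq (x : nat) k.-1; last first.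
  exists (i, ord0); rewrite ?firecrackerE /= ?eqxx /=; first by lia.
  have := neq; rewrite -!val_eqE /= => neq'.
  by rewrite /fdist /depth; repeat case: ifP; lia.
have [eq_ij|neq_ij] := eqVneq i j.
  exists (i, ord0); rewrite ?firecrackerE /= ?eqxx /=; first by lia.
  have := neq; rewrite -!val_eqE /= eq_ij eqxx /= => neq'.
  by rewrite /fdist /depth; repeat case: ifP; lia.
have neq' : i != j :> nat by [].
have [lt_ij|le_ji] := ltnP i j.
  have lt_n : i.+1 < n by apply: leq_ltn_trans (ltn_ord j).
  exists (Ordinal lt_n, ord_max); rewrite ?firecrackerE /=; first by lia.
  by rewrite /fdist /depth; repeat case: ifP; lia.
have lt_n : i.-1 < n by apply: leq_ltn_trans (leq_pred _) (ltn_ord i).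
exists (Ordinal lt_n, ord_max); rewrite ?firecrackerE /=; first by lia.
by rewrite /fdist /depth; repeat case: ifP; lia.
Qed.

Lemma firecracker_gdist (u v : T) :
  gdist (@firecracker n k) u v = fdist k u.1 u.2 v.1 v.2.
Proof.
apply: (gdist_eq (d := fun u v : T => fdist k u.1 u.2 v.1 v.2))
  => {u v} [u|u v||u v].
- by rewrite /fdist !eqxx.
- rewrite card_firecracker; apply: (@leq_trans (n + 3)); first exact: fdist_le_diam.
  by apply: (@leq_trans (n * 3)); [lia | rewrite leq_mul2l hk orbT].
- exact: fdist_adj.
- exact: fdist_desc.
Qed.

Lemma firecracker_gdiam : gdiam (@firecracker n k) = n + 3.
Proof.
apply/eqP; rewrite eqn_leq; apply/andP; split.
  apply/bigmax_leqP => u _; apply/bigmax_leqP => v _.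
  by rewrite firecracker_gdist; apply: fdist_le_diam.
have n_gt0 : 0 < n by apply: leq_trans hn.
have n1_lt : n.-1 < n by rewrite prednK.
have k1 : 1 < k.-1.+1 by lia.
(* Leaves of the first and last copies: n - 1 along the path and 2 at each end. Index 1 is a free
   leaf because k is at least 3. *)
pose u : T := (Ordinal n_gt0, Ordinal k1).
pose v : T := (Ordinal n1_lt, Ordinal k1).
apply: leq_trans (leq_bigmax u); apply: leq_trans (leq_bigmax v).
rewrite firecracker_gdist /= /fdist /depth.
by repeat case: ifP; lia.
Qed.

End FirecrackerDistance.

(** * Bounds on the radio number of a graph *)

Section RadioBounds.
Variables (T : finType) (e : rel T).

Lemma leq_radio_number b :
  (forall f, radio_labeling e f -> b <= label_span f) -> b <= radio_number e.
Proof.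
move=> b_min; rewrite /radio_number.
case: ex_minnP => s /boolp.asboolP[f rad_f <-] _.
exact: b_min.
Qed.

Lemma radio_number_le f : radio_labeling e f -> radio_number e <= label_span f.
Proof.
move=> rad_f; rewrite /radio_number; case: ex_minnP => s _; apply.
by apply/boolp.asboolP; exists f.
Qed.

Lemma leq_label_span (f : T -> nat) u v : f v <= f u + label_span f.
Proof.
have: `|f u - f v|%N <= label_span f.
  apply: leq_trans (leq_bigmax u); exact: (leq_bigmax v).
lia.
Qed.

Variables (L : T -> nat) (D : nat).

Lemma radio_span_lower_bound (f : T -> nat) o :
    radio_labeling e f -> 1 < #|T| ->
    (forall u v, D + gdist e u v <= gdiam e + 1 + L u + L v) ->
    (forall u v, u != v -> o <= L u + L v) ->
  #|T|.-1 * D + o <= label_span f + 2 * \sum_u L u.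
Proof.
move=> rad_f T_gt1 distL o_le; set r : rel T := relpre f leq.
(* The telescoped inequality along a list with nondecreasing labels, with all subtractions moved
   across. *)
have path_bound x p : path r x p -> uniq (x :: p) ->
    size p * D + L x + L (last x p) + f x
      <= f (last x p) + 2 * \sum_(u <- x :: p) L u.
  elim: p x => [|y p IHp] x; first by rewrite /= big_seq1; lia.
  rewrite [path _ _ _]/= /r /relpre /= -/r big_cons inE negb_or -andbA.
  case/andP=> le_xy yp /and3P[neq_xy _ uniq_yp].
  have := IHp y yp uniq_yp; have := rad_f x y neq_xy; have := distL x y.
  by rewrite mulSn mulnDr; move: le_xy; lia.
have size_s : size (sort r (enum T)) = #|T| by rewrite size_sort -cardE.
have perm_s : perm_eq (sort r (enum T)) (enum T) by rewrite perm_sort.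
have uniq_s : uniq (sort r (enum T)) by rewrite sort_uniq enum_uniq.
have sort_s : sorted r (sort r (enum T)).
  by apply: sort_sorted => x y; apply: leq_total.
have <- : \sum_(u <- sort r (enum T)) L u = \sum_u L u.
  by rewrite (perm_big _ perm_s) big_enum.
case: (sort r _) size_s uniq_s sort_s {perm_s} => [|x [|y p]] size_s.
- by rewrite -size_s in T_gt1.
- by rewrite -size_s in T_gt1.
move=> uniq_s sort_s; have := path_bound x (y :: p) sort_s uniq_s.
have neq : x != last x (y :: p).
  apply: contraTneq uniq_s => {1}->.
  by rewrite cons_uniq /= mem_last.
have := o_le _ _ neq; have := leq_label_span f x (last x (y :: p)).
by rewrite -size_s [size (x :: _)]/= -pred_Sn [size (y :: _)]/=; lia.
Qed.

Variable s : nat -> T.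

(* The labels for which every consecutive inequality of the lower bound is an  *)
(* equality; the hypothesis [L_le] keeps the subtraction from truncating.      *)
Fixpoint gap_label (t : nat) : nat :=
  if t is t'.+1 then gap_label t' + (D - (L (s t') + L (s t))) else 0.

Hypothesis L_le : forall u v, L u + L v <= D.

Lemma gap_labelE t :
  gap_label t + 2 * \sum_(i < t.+1) L (s i) = t * D + L (s 0) + L (s t).
Proof.
elim: t => [|t IHt]; first by rewrite big_ord_recr big_ord0 /=; lia.
rewrite big_ord_recr (mulSn t) /=; have := L_le (s t) (s t.+1); move: IHt.
by move: (\sum_(i < t.+1) L (s i)) => S; lia.
Qed.

Lemma gap_label_mono i j : i <= j -> gap_label i <= gap_label j.
Proof.
move=> /subnKC <-; elim: (j - i) => [|d IHd]; first by rewrite addn0.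
by rewrite addnS /= (leq_trans IHd) ?leq_addr.
Qed.

Variable pos : T -> nat.
Hypotheses (pos_lt : forall u, pos u < #|T|) (posK : cancel pos s).

(** [pos] is injective into [#|T|] positions, hence bijective, so [s] enumerates the vertices. *)
Lemma sum_ordering (G : T -> nat) : \sum_(i < #|T|) G (s i) = \sum_u G u.
Proof.
pose h u := Ordinal (pos_lt u).
have h_inj : injective h by move=> u v [] /(can_inj posK).
have h_bij : bijective h by apply: inj_card_bij; rewrite ?card_ord.
rewrite (reindex h); last exact: onW_bij.
by apply: eq_bigr => u _; rewrite /= posK.
Qed.

Lemma orderingK i : i < #|T| -> pos (s i) = i.
Proof.
move=> lt_i; pose h u := Ordinal (pos_lt u).
have h_inj : injective h by move=> u v [] /(can_inj posK).
have [h' _ h'K] : bijective h by apply: inj_card_bij; rewrite ?card_ord.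
have /(congr1 val)/= def_i := h'K (Ordinal lt_i).
by rewrite -[in s i]def_i posK def_i.
Qed.

Lemma radio_number_upper_bound :
    0 < #|T| ->
    (forall i j, i < j -> j < #|T| ->
      gdiam e + 1 <= gdist e (s i) (s j) + (gap_label j - gap_label i)) ->
    (forall u v, gdist e u v = gdist e v u) ->
  radio_number e + 2 * \sum_u L u <= #|T|.-1 * D + L (s 0) + L (s #|T|.-1).
Proof.
move=> T_gt0 rad_s sym_d; pose f u := gap_label (pos u).
have rad_f : radio_labeling e f.
  move=> u v neq_uv; have neq_pos : pos u != pos v.
    by apply: contraNneq neq_uv => /(can_inj posK)->.
  have [lt_uv|lt_vu|eq_uv] := ltngtP (pos u) (pos v); last by case/eqP: neq_pos.
    have := rad_s _ _ lt_uv (pos_lt v); rewrite !posK /f.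
    by have := gap_label_mono (ltnW lt_uv); lia.
  have := rad_s _ _ lt_vu (pos_lt u); rewrite !posK /f (sym_d v).
  by have := gap_label_mono (ltnW lt_vu); lia.
rewrite -gap_labelE prednK // sum_ordering leq_add2r.
apply: leq_trans (radio_number_le rad_f) _.
apply/bigmax_leqP => u _; apply/bigmax_leqP => v _; rewrite /f.
have le_last w : pos w <= #|T|.-1 by rewrite -ltnS prednK.
have := gap_label_mono (le_last u); have := gap_label_mono (le_last v); lia.
Qed.

End RadioBounds.

(** * Gaps along the tour *)

Lemma half_eq n : n = odd n + 2 * n./2.
Proof. by rewrite mul2n odd_double_half. Qed.

(** Inside one copy, a geodesic saves at most the detour from the star centre to the path vertex and
    back. *)
Lemma fdist_ge k i x j y : (i, x) != (j, y) ->
  i - j + (j - i) + depth k x + depth k y <= fdist k i x j y + (i == j).*2.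
Proof.
rewrite xpair_eqE /fdist; case: eqP => [->|_ _]; last by rewrite addn0.
by rewrite /depth; case: (x =P y) => //=; repeat case: eqP => //=; lia.
Qed.

Lemma fdist_gt0 k i x j y : (i, x) != (j, y) -> 0 < fdist k i x j y.
Proof.
rewrite xpair_eqE /fdist; case: eqP => /=; last by lia.
by case: eqP => // _; case: ifP.
Qed.

Lemma fdist_sym k i x j y : fdist k i x j y = fdist k j y i x.
Proof.
rewrite /fdist [j == i]eq_sym [y == x]eq_sym orbC; case: eqP => //; lia.
Qed.

(* The distance from the path vertex [i] to the weight centre [n./2], or to the *)
(* nearer of the weight centres [n./2 - 1] and [n./2] when [n] is even.        *)
Definition lev (n i : nat) : nat :=
  if i < n./2 then n./2 + odd n - i.+1 else i - n./2.

(* One step of the cyclic tour of the copies that alternates between the two   *)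
(* sides of the tree, a far copy being followed by a near one.                *)
Definition next_copy (n c : nat) : nat :=
  if c < n./2 then if c + n./2 + 1 < n then c + n./2 + 1 else n./2
  else c - n./2.

(* The second case is the one place of the odd tour where a visit to the       *)
(* middle copy is skipped; there no leaf can be used on either side.          *)
Definition link (n k c x c' x' : nat) : Prop :=
  c' = next_copy n c \/
  [/\ odd n, c = n.-1, c' = 0, depth k x = 0 & depth k x' = 1].

Section Windows.
Variables n k : nat.
Hypothesis hn : 3 <= n.

Let D := n + 3 + odd n.
Local Notation L c x := (lev n c + depth k x).
Local Notation gap c x c' x' := (D - (L c x + L c' x')).

Let n_eq := half_eq n.

(** The cases are: from left to right, the wrap between the two weight centres for even [n], from
    right to left (or to the middle copy), and the skip for odd [n]. Keeping the depths on the side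
    of the gap makes everything linear. *)
Lemma link_gap c x c' x' : c < n -> link n k c x c' x' ->
  [\/ c < n./2 /\ c' = c + n./2 + 1 /\ c' < n /\
        gap c x c' x' + depth k x + depth k x' = n./2 + odd n + 3,
      odd n = 0 :> nat /\ c.+1 = n./2 /\ c' = n./2 /\
        gap c x c' x' + depth k x + depth k x' = n + 3,
      n./2 <= c /\ c' + n./2 = c /\
        gap c x c' x' + depth k x + depth k x' = n./2 + odd n + 4 |
      odd n = 1 :> nat /\ c.+1 = n /\ c' = 0 /\ gap c x c' x' = 4 /\
        depth k x = 0 /\ depth k x' = 1].
Proof.
have := depth_le2 k x; have := depth_le2 k x'; have := leq_b1 (odd n).
rewrite /link /next_copy /lev /D.
move: n_eq hn; move: (depth k x) (depth k x') (odd n) (n./2) => d d' o m.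
move=> n_eq' n_ge3 o_le1 d'_le2 d_le2 c_lt; case; last first.
  case=> o1 c_eq c'_eq d0 d1; constructor 4.
  case: (ltnP c m); case: (ltnP c' m) => ? ?; lia.
case: (ltnP c m) => c_m; last first.
  move=> c'_eq; constructor 3; case: (ltnP c' m) => ?; lia.
case: ltnP => c'_lt ->; [constructor 1 | constructor 2].
  by case: (ltnP (c + m + 1) m) => ?; lia.
by rewrite ltnn; lia.
Qed.

Lemma window1 c0 x0 c1 x1 :
  c0 < n -> (c0, x0) != (c1, x1) -> link n k c0 x0 c1 x1 ->
  n + 4 <= fdist k c0 x0 c1 x1 + gap c0 x0 c1 x1.
Proof.
move=> lt0 neq /(link_gap lt0); move: (gap _ _ _ _) => g lk.
have := leq_b1 (odd n); have := fdist_ge k neq; move: n_eq hn.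
by case: (c0 =P c1) => eq_c /=; case: lk; lia.
Qed.

(** For distinct copies the depths of the end vertices cancel against the distance; only the middle
    depth is lost, twice, and it is at most 2. *)
Lemma window2 c0 x0 c1 x1 c2 x2 :
  c0 < n -> c1 < n -> (c0, x0) != (c2, x2) ->
  link n k c0 x0 c1 x1 -> link n k c1 x1 c2 x2 ->
  n + 4 <= fdist k c0 x0 c2 x2 + (gap c0 x0 c1 x1 + gap c1 x1 c2 x2).
Proof.
move=> lt0 lt1 neq /(link_gap lt0) lk /(link_gap lt1); move: lk.
move: (gap c0 x0 c1 x1) (gap c1 x1 c2 x2) => g g' lk lk'.
have := leq_b1 (odd n); have := fdist_ge k neq; have := fdist_gt0 k neq.
have := depth_le2 k x0; have := depth_le2 k x1; have := depth_le2 k x2.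
move: n_eq hn.
by case: (c0 =P c2) => eq_c /=; case: lk => ?; case: lk'; lia.
Qed.

Lemma window3 c0 x0 c1 x1 c2 x2 c3 x3 :
  c0 < n -> c1 < n -> c2 < n -> (c0, x0) != (c3, x3) ->
  link n k c0 x0 c1 x1 -> link n k c1 x1 c2 x2 -> link n k c2 x2 c3 x3 ->
  n + 4 <= fdist k c0 x0 c3 x3
           + (gap c0 x0 c1 x1 + gap c1 x1 c2 x2 + gap c2 x2 c3 x3).
Proof.
move=> lt0 lt1 lt2 neq /(link_gap lt0) lk /(link_gap lt1) lk' /(link_gap lt2).
move: lk lk'; move: (gap c0 x0 c1 x1) (gap c1 x1 c2 x2) (gap c2 x2 c3 x3).
move=> g g' g'' lk lk' lk''.
have := leq_b1 (odd n); have := fdist_ge k neq; have := fdist_gt0 k neq.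
have := depth_le2 k x0; have := depth_le2 k x1; have := depth_le2 k x2.
have := depth_le2 k x3; move: n_eq hn.
by case: (c0 =P c3) => eq_c /=; case: lk => ?; case: lk' => ?; case: lk''; lia.
Qed.

(** The bound is one less than required; the distance between distinct vertices supplies the missing
    1. *)
Lemma window4 c0 x0 c1 x1 c2 x2 c3 x3 c4 x4 :
  c0 < n -> c1 < n -> c2 < n -> c3 < n ->
  link n k c0 x0 c1 x1 -> link n k c1 x1 c2 x2 -> link n k c2 x2 c3 x3 ->
  link n k c3 x3 c4 x4 ->
  n + 3 <= gap c0 x0 c1 x1 + gap c1 x1 c2 x2 + gap c2 x2 c3 x3 + gap c3 x3 c4 x4.
Proof.
move=> lt0 lt1 lt2 lt3 /(link_gap lt0) lk0 /(link_gap lt1) lk1.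
move=> /(link_gap lt2) lk2 /(link_gap lt3); move: lk0 lk1 lk2.
move: (gap c0 x0 c1 x1) (gap c1 x1 c2 x2) (gap c2 x2 c3 x3) (gap c3 x3 c4 x4).
move=> g0 g1 g2 g3 lk0 lk1 lk2 lk3.
have := depth_le2 k x0; have := depth_le2 k x1; have := depth_le2 k x2.
have := depth_le2 k x3; have := depth_le2 k x4.
have := leq_b1 (odd n); move: n_eq hn.
by case: lk0 => ?; case: lk1 => ?; case: lk2 => ?; case: lk3; lia.
Qed.

End Windows.

(** * Weight and bounds for firecrackers *)

Section Weight.
Variable n : nat.

Lemma double_sum_nat p : 2 * \sum_(0 <= i < p) i + p = p * p.
Proof.
elim: p => [|p IHp]; first by rewrite big_geq.
by rewrite big_nat_recr //= mulnDr; move: IHp; lia.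
Qed.

Lemma sum_lev : \sum_(i < n) lev n i + n./2 = n./2 * n./2 + 2 * odd n * n./2.
Proof.
rewrite -(big_mkord xpredT (lev n)) (@big_cat_nat _ _ _ n./2) //=; last first.
  by rewrite {2}(half_eq n); lia.
(* Read outwards from the centre, the left levels start at [odd n] and the right ones at 0. *)
have -> : \sum_(0 <= i < n./2) lev n i = \sum_(0 <= i < n./2) (odd n + i).
  rewrite big_nat_rev [LHS]big_nat_cond [RHS]big_nat_cond; apply: eq_bigr => i.
  by rewrite /lev add0n andbT => lt_i; case: ltnP; lia.
have -> : \sum_(n./2 <= i < n) lev n i = \sum_(0 <= i < n - n./2) i.
  rewrite -{1}[n./2]add0n big_addn; apply: eq_bigr => i _.
  by rewrite /lev ltnNge leq_addl /= addnK.
have -> : n - n./2 = odd n + n./2 by rewrite {1}(half_eq n); lia.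
rewrite big_split sum_nat_const_nat subn0 /=.
have := double_sum_nat n./2; have := double_sum_nat (odd n + n./2).
move: (\sum_(0 <= i < odd n + n./2) i) (\sum_(0 <= i < n./2) i) => S S'.
move: n./2 => m.
by case: (odd n) => /=; lia.
Qed.

Lemma sum_depth k : 3 <= k -> \sum_(x < k.-1.+1) depth k x + 3 = 2 * k.
Proof.
case: k => [|[|k]] // k_gt0; rewrite big_ord_recr big_ord_recl /= /depth eqxx /=.
rewrite (eq_bigr (fun=> 2)) => [|i _]; last first.
  by rewrite /bump /= add1n eqSS; have /ltn_eqF-> := ltn_ord i.
by rewrite sum_nat_const card_ord eqxx; lia.
Qed.

End Weight.

Section Bounds.
Variables n k : nat.
Hypotheses (hn : 3 <= n) (hk : 3 <= k).
Notation T := ('I_n * 'I_k.-1.+1)%type.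
Notation D := (n + 3 + odd n).

Definition vlev (u : T) : nat := lev n u.1 + depth k u.2.

Lemma sum_vlev :
  \sum_(u : T) vlev u =
    k * \sum_(i < n) lev n i + n * \sum_(x < k.-1.+1) depth k x.
Proof.
rewrite -(pair_bigA _ (fun (i : 'I_n) (x : 'I_k.-1.+1) =>
  lev n i + depth k x)) /=.
under eq_bigr do rewrite big_split sum_nat_const card_ord /=.
by rewrite big_split -big_distrr /= sum_nat_const card_ord prednK //; lia.
Qed.

Lemma firecracker_lower_bound :
  (n * k).-1 * D + odd n
    <= radio_number (@firecracker n k) + 2 * \sum_(u : T) vlev u.
Proof.
rewrite [X in _ <= X]addnC -leq_subLR; apply: leq_radio_number => f rad_f.
rewrite leq_subLR [X in _ <= X]addnC -(card_firecracker n hk).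
apply: (radio_span_lower_bound rad_f).
- by rewrite card_firecracker // (leq_trans _ (leq_mul hn hk)).
- move=> u v; rewrite firecracker_gdist // firecracker_gdiam //.
  have := fdist_le k u.1 u.2 v.1 v.2; rewrite /vlev /lev.
  have := half_eq n; have := ltn_ord u.1; have := ltn_ord v.1.
  move: (fdist _ _ _ _ _) (depth _ _) (depth _ _) => d d1 d2.
  move: (u.1 : nat) (v.1 : nat) (leq_b1 (odd n)) => i j.
  move: (odd n : nat) (n./2) => o m.
  by case: (ltnP i m); case: (ltnP j m); lia.
(* For odd [n] the middle path vertex is the only vertex of level 0. *)
- move=> u v; rewrite /vlev /lev => neq.
case: (boolP (odd n)) => [n_odd|_] //=.
have := half_eq n; rewrite n_odd /=.
move: neq; case: u v => [i x] [j y]; rewrite xpair_eqE -!val_eqE /= /depth.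
move: (i : nat) (j : nat) (x : nat) (y : nat) => {}i {}j {}x {}y.
by case: (ltnP i _) => ?; case: (ltnP j _) => ?; repeat (case: eqP => //= ?); lia.
Qed.

Lemma vlev_le (u v : T) : vlev u + vlev v <= D.
Proof.
have lev_le (i : 'I_n) : lev n i < n./2 + odd n.
  have := half_eq n; have := ltn_ord i; rewrite /lev.
  move: (i : nat) (leq_b1 (odd n)) => {}i; move: (odd n : nat) (n./2) => o m.
  by case: (ltnP i m); lia.
have := lev_le u.1; have := lev_le v.1; have := half_eq n; rewrite /vlev.
by have := depth_le2 k u.2; have := depth_le2 k v.2; lia.
Qed.

Variables (s : nat -> T) (pos : T -> nat).
Hypotheses (pos_lt : forall u, pos u < n * k) (posK : cancel pos s).
Hypothesis links : forall t, t.+1 < n * k ->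
  link n k (s t).1 (s t).2 (s t.+1).1 (s t.+1).2.

Lemma linked_ordering_radio i j : i < j -> j < n * k ->
  n + 4 <= fdist k (s i).1 (s i).2 (s j).1 (s j).2
           + (gap_label vlev D s j - gap_label vlev D s i).
Proof.
move=> lt_ij lt_j.
have neq : ((s i).1 : nat, (s i).2 : nat) != ((s j).1 : nat, (s j).2 : nat).
  have : s i != s j.
    have lt_i := ltn_trans lt_ij lt_j.
    have pos_ltT u : pos u < #|{: T}| by rewrite card_firecracker.
    have seqK t : t < n * k -> pos (s t) = t.
      by rewrite -(card_firecracker n hk); apply: orderingK pos_ltT posK _.
    apply: contraTneq lt_ij => eq_s.
    by rewrite -(seqK _ lt_j) -eq_s seqK ?ltnn.
  by case: (s i) (s j) => [? ?] [? ?]; rewrite !xpair_eqE.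
have [d def_j] : exists d, j = i + d.+1 by exists (j - i.+1); lia.
case: d def_j => [|[|[|d]]] def_j.
- rewrite {}def_j !(addnS, addn0) in lt_j neq *.
  have := @window1 n k hn _ _ _ _ (ltn_ord (s i).1) neq (links lt_j).
  by rewrite /= /vlev; lia.
- rewrite {}def_j !(addnS, addn0) in lt_j neq *; have lt_i := ltnW lt_j.
  have := @window2 n k hn _ _ _ _ _ _ (ltn_ord _) (ltn_ord _) neq
            (links lt_i) (links lt_j).
  by rewrite /= /vlev; lia.
- rewrite {}def_j !(addnS, addn0) in lt_j neq *.
  have lt_i1 := ltnW lt_j; have lt_i := ltnW lt_i1.
  have := @window3 n k hn _ _ _ _ _ _ _ _ (ltn_ord _) (ltn_ord _) (ltn_ord _)
            neq (links lt_i) (links lt_i1) (links lt_j).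
  by rewrite /= /vlev; lia.
have lt4 : i.+4 < n * k by lia.
have lt3 := ltnW lt4; have lt2 := ltnW lt3; have lt1 := ltnW lt2.
have := @window4 n k hn _ _ _ _ _ _ _ _ _ _ (ltn_ord _) (ltn_ord _) (ltn_ord _)
          (ltn_ord _) (links lt1) (links lt2) (links lt3) (links lt4).
have le4 : i.+4 <= j by lia.
have := fdist_gt0 k neq; have := @gap_label_mono _ vlev D s _ _ le4.
by rewrite /= /vlev; lia.
Qed.

Hypothesis ends : vlev (s 0) + vlev (s (n * k).-1) = odd n.

Lemma firecracker_upper_bound :
  radio_number (@firecracker n k) + 2 * \sum_(u : T) vlev u
    <= (n * k).-1 * D + odd n.
Proof.
have cardT := card_firecracker n hk.
rewrite -[X in _ <= _ + X]ends addnA -cardT.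
have pos_ltT u : pos u < #|{: T}| by rewrite cardT.
apply: (radio_number_upper_bound vlev_le pos_ltT posK) => [|i j lt_ij lt_j|u v].
- by rewrite cardT muln_gt0; lia.
- rewrite firecracker_gdist // firecracker_gdiam // -addnA.
  by apply: linked_ordering_radio; rewrite // -cardT.
- by rewrite !firecracker_gdist // fdist_sym.
Qed.

End Bounds.

(** * The extremal orderings *)

Section Orderings.
Variables n k : nat.
Hypotheses (hn : 3 <= n) (hk : 3 <= k).
Notation T := ('I_n * 'I_k.-1.+1)%type.

(* The copy visited at step [j] of a tour: [n./2], [0], [n./2 + 1], [1], ...    *)
Definition cyc (j : nat) : nat := j./2 + (if odd j then 0 else n./2).

(** The inverse of [cyc]: left copies occupy the odd steps, the others the even steps. *)
Definition slot (i : nat) : nat :=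
  if i < n./2 then i.*2.+1 else (i - n./2).*2.

Lemma slot_lt i : i < n -> slot i < n.
Proof.
have := half_eq n; have := leq_b1 (odd n); rewrite /slot -!muln2.
by move: (odd n : nat) n./2 => o m; case: (ltnP i m); lia.
Qed.

Lemma slotK i : i < n -> cyc (slot i) = i.
Proof.
move=> lt_i; rewrite /cyc /slot; case: ltnP => le_i /=.
  by rewrite odd_double uphalf_double addn0.
by rewrite odd_double doubleK subnK.
Qed.

Lemma cyc_lt j : j < n -> cyc j < n.
Proof.
have := half_eq n; have := leq_b1 (odd n); have := half_eq j; rewrite /cyc.
by move: (odd n : nat) n./2 => o m; case: (odd j) => /=; lia.
Qed.

Lemma cyc_next j : j < n ->
  cyc (if j.+1 == n then 0 else j.+1) = next_copy n (cyc j).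
Proof.
move=> lt_j; have n_eq := half_eq n; have j_eq := half_eq j.
have o_le := leq_b1 (odd n).
have odd_n : j.+1 = n -> odd n + odd j = 1 by move<-; rewrite /=; case: (odd j).
have [c def_c] : exists c, c = cyc j by exists (cyc j).
rewrite -def_c /next_copy; move: def_c odd_n n_eq j_eq o_le.
case: eqP => eq_n; rewrite /cyc /= ?uphalf_half;
  move: (odd n : nat) n./2 j./2 => o m h; case: (odd j) => /=;
  case: (ltnP c m) => ?; case: (ltnP (c + m + 1) n); lia.
Qed.

Lemma modS t : t.+1 %% n = if (t %% n).+1 == n then 0 else (t %% n).+1.
Proof.
have n_gt0 : 0 < n by apply: leq_trans hn.
rewrite -addn1 -modnDml addn1; case: eqP => [->|neq]; first by rewrite modnn.
by rewrite modn_small //; have := ltn_pmod t n_gt0; lia.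
Qed.

Lemma cyc_modS t : cyc (t.+1 %% n) = next_copy n (cyc (t %% n)).
Proof. by rewrite modS cyc_next // ltn_pmod //; apply: leq_trans hn. Qed.

(** The defaults of [insubd] and [inord] are never reached when [c < n] and [x < k]. *)
Definition vertex (c x : nat) : T := (insubd (Ordinal (ltnW (ltnW hn))) c, inord x).

Lemma vertex1 c x : c < n -> (vertex c x).1 = c :> nat.
Proof. by move=> lt_c; rewrite /= val_insubd lt_c. Qed.

Lemma vertex2 c x : x < k -> (vertex c x).2 = x :> nat.
Proof. by move=> lt_x; rewrite /= inordK // prednK //; apply: leq_trans hk. Qed.

Lemma vertexE (u : T) : vertex u.1 u.2 = u.
Proof.
case: u => i x; congr (_, _); apply: val_inj => /=.
  by rewrite val_insubd ltn_ord.
by rewrite inord_val.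
Qed.

(* Every tour visits each copy once. The order in which a copy spends its      *)
(* vertices puts the two weight centres at the ends.                          *)
Definition even_copy (t : nat) := cyc (t %% n).
Definition even_star (t : nat) :=
  if even_copy t < n./2 then t %/ n else k.-1 - t %/ n.
Definition even_seq (t : nat) : T := vertex (even_copy t) (even_star t).
Definition even_pos (u : T) : nat :=
  (if u.1 < n./2 then u.2 : nat else k.-1 - u.2) * n + slot u.1.

(* For odd [n] the last tour starts one step late and visits the middle copy   *)
(* last: the ordering then runs from the star centre of the middle copy to    *)
(* its path vertex.                                                           *)
Definition odd_copy (t : nat) := cyc ((t + (k.-1 * n <= t)) %% n).
(** Outside the middle copy the star centre comes last, preceded by the path vertex; these are the
    depths 0 and 1 that [link] demands at the skip. *)
Definition odd_star (t : nat) :=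
  if odd_copy t == n./2 then t %/ n else (t %/ n).+1 %% k.
Definition odd_seq (t : nat) : T := vertex (odd_copy t) (odd_star t).
Definition odd_round (u : T) : nat :=
  if u.1 == n./2 :> nat then u.2 : nat
  else if u.2 == 0 :> nat then k.-1 else u.2.-1.
(** In the last round every slot moves back by one cyclically, which sends the middle copy from
    first to last. *)
Definition odd_pos (u : T) : nat :=
  odd_round u * n
    + if odd_round u == k.-1 then (slot u.1 + n.-1) %% n else slot u.1.

Let n_gt0 : 0 < n. Proof. exact: leq_trans hn. Qed.
Let k_gt0 : 0 < k. Proof. exact: leq_trans hk. Qed.

Lemma copy_lt t : cyc (t %% n) < n.
Proof. by rewrite cyc_lt // ltn_pmod. Qed.

Lemma round_lt r q : r < k -> q < n -> r * n + q < n * k.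
Proof. by move=> lt_r lt_q; nia. Qed.

Lemma ord_lt (x : 'I_k.-1.+1) : x < k.
Proof. by rewrite -[k in _ < k](prednK k_gt0). Qed.

Lemma even_pos_lt u : even_pos u < n * k.
Proof.
apply: round_lt; last exact: slot_lt.
by have := ord_lt u.2; case: ifP; lia.
Qed.

Lemma even_posK : cancel even_pos even_seq.
Proof.
move=> u; rewrite /even_seq /even_pos; set r := (X in X * n); set t := _ + _.
have lt_s : slot u.1 < n by exact: slot_lt.
have copy_t : even_copy t = u.1.
  by rewrite /even_copy /t modnMDl modn_small // slotK.
have -> : even_star t = u.2; last by rewrite copy_t vertexE.
rewrite /even_star copy_t /t divnMDl // divn_small // addn0 /r.
by case: ltnP => // _; rewrite subKn // -ltnS.
Qed.

Lemma even_links t : t.+1 < n * k ->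
  link n k (even_seq t).1 (even_seq t).2 (even_seq t.+1).1 (even_seq t.+1).2.
Proof.
move=> _; left; rewrite !vertex1 ?copy_lt //; exact: cyc_modS.
Qed.

Lemma odd_round_lt u : odd_round u < k.
Proof. by have := ord_lt u.2; rewrite /odd_round; repeat case: ifP; lia. Qed.

Lemma odd_pos_lt u : odd_pos u < n * k.
Proof.
apply: round_lt; first exact: odd_round_lt.
by case: ifP => _; [rewrite ltn_pmod | apply: slot_lt].
Qed.

Lemma odd_posK : cancel odd_pos odd_seq.
Proof.
move=> u; rewrite /odd_seq; set t := odd_pos u.
have lt_s : slot u.1 < n by exact: slot_lt.
have lt_r := odd_round_lt u.
have div_t : t %/ n = odd_round u.
  rewrite /t /odd_pos divnMDl // divn_small ?addn0 //.
  by case: ifP => _; rewrite ?ltn_pmod.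
have copy_t : odd_copy t = u.1.
  rewrite /odd_copy -[RHS](slotK (ltn_ord u.1)); congr cyc.
  (* The late start depends only on the round [t %/ n], and its shift by one undoes the one in
     [odd_pos]. *)
  rewrite -leq_divRL // div_t /t /odd_pos; case: eqP => [->|neq].
    rewrite leqnn -addnA modnMDl modnDml -addnA addn1 (prednK n_gt0).
    by rewrite modnDr modn_small.
  have -> : (k.-1 <= odd_round u) = false by lia.
  by rewrite addn0 modnMDl modn_small.
have -> : odd_star t = u.2; last by rewrite copy_t vertexE.
rewrite /odd_star copy_t div_t /odd_round; case: (u.1 =P n./2 :> nat) => // _.
have lt_x := ord_lt u.2; case: (u.2 =P 0 :> nat) => [-> | ?].
  by rewrite (prednK k_gt0) modnn.
by rewrite (@prednK u.2) ?modn_small //; lia.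
Qed.

Lemma odd_links t : odd n -> t.+1 < n * k ->
  link n k (odd_seq t).1 (odd_seq t).2 (odd_seq t.+1).1 (odd_seq t.+1).2.
Proof.
move=> n_odd lt_t; rewrite /link !vertex1 ?copy_lt //.
have [lt_t1|lt_t1|eq_t] := ltngtP t.+1 (k.-1 * n).
- left; rewrite /odd_copy leqNgt lt_t1 leqNgt (ltnW lt_t1) !addn0.
  exact: cyc_modS.
- left; rewrite /odd_copy (ltnW lt_t1) -ltnS lt_t1 !addn1.
  exact: cyc_modS.
(* Entering the last tour: from the path vertex of copy [n.-1] to the star centre of copy 0. *)
right.
have mod_t : t %% n = n.-1.
  have := modS t; rewrite eq_t modnMl; case: eqP => //; lia.
have copy_t : odd_copy t = n.-1.
  rewrite /odd_copy -eq_t ltnn addn0 mod_t /cyc.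
  have odd_n1 : odd n.-1 = false.
    by move: n_odd; rewrite -{1}(prednK n_gt0) /= => /negPf.
  rewrite odd_n1.
  have := half_eq n; have := half_eq n.-1.
  by rewrite odd_n1 n_odd /=; lia.
have copy_t1 : odd_copy t.+1 = 0.
  rewrite /odd_copy eq_t leqnn modnMDl modn_small //; exact: ltnW.
have div_t1 : t.+1 %/ n = k.-1 by rewrite eq_t mulnK.
have div_t : t %/ n = k.-2.
  have eq_q : (t %/ n).+1 * n = k.-1 * n.
    by rewrite -eq_t {2}(divn_eq t n) mod_t mulSn; lia.
  by move/eqP: eq_q; rewrite eqn_pmul2r // => /eqP; lia.
have half_n : 0 < n./2 /\ n./2 < n.-1.
  by have := half_eq n; rewrite n_odd /=; lia.
rewrite copy_t copy_t1 !vertex2 /odd_star ?copy_t ?copy_t1 ?div_t ?div_t1.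
- split=> //.
  - have -> : (n.-1 == n./2) = false by lia.
    have -> : k.-2.+1 = k.-1 by lia.
    by rewrite modn_small ?prednK // /depth eqxx.
  - have -> : (0 == n./2) = false by lia.
    rewrite prednK // modnn /depth; have -> : (0 == k.-1) = false by lia.
    by [].
- by case: ifP => _; [lia | rewrite ltn_pmod].
- by case: ifP => _; [lia | rewrite ltn_pmod].
Qed.

Let pred_nk : (n * k).-1 = k.-1 * n + n.-1.
Proof. by rewrite -{1}(prednK k_gt0) mulnC mulSn; lia. Qed.

Lemma even_ends : ~~ odd n ->
  (lev n (even_seq 0).1 + depth k (even_seq 0).2)
    + (lev n (even_seq (n * k).-1).1 + depth k (even_seq (n * k).-1).2) = 0.
Proof.
move=> n_even.
have copy0 : even_copy 0 = n./2 by rewrite /even_copy mod0n /cyc.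
have odd_n1 : odd n.-1 by move: n_even; rewrite -{1}(prednK n_gt0) /= negbK.
have copy1 : even_copy (n * k).-1 = n./2.-1.
  rewrite /even_copy pred_nk modnMDl modn_small ?prednK // /cyc odd_n1.
  have := half_eq n; have := half_eq n.-1.
  by rewrite odd_n1 (negPf n_even) /=; lia.
have star0 : even_star 0 = k.-1 by rewrite /even_star copy0 ltnn div0n subn0.
have half_gt0 : 0 < n./2 by have := half_eq n; have := leq_b1 (odd n); lia.
have star1 : even_star (n * k).-1 = k.-1.
  rewrite /even_star copy1 prednK // leqnn pred_nk.
  by rewrite divnMDl // divn_small ?prednK // addn0.
rewrite !vertex1 ?copy_lt // !vertex2 ?star0 ?star1 ?ltn_predL //.
rewrite copy0 copy1 /depth eqxx /lev ltnn prednK // leqnn (negPf n_even).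
by lia.
Qed.

Lemma odd_ends : odd n ->
  (lev n (odd_seq 0).1 + depth k (odd_seq 0).2)
    + (lev n (odd_seq (n * k).-1).1 + depth k (odd_seq (n * k).-1).2) = 1.
Proof.
move=> n_odd.
have copy0 : odd_copy 0 = n./2.
  rewrite /odd_copy leqn0 muln_eq0.
  have -> : (k.-1 == 0) || (n == 0) = false by lia.
  by rewrite mod0n /cyc.
have copy1 : odd_copy (n * k).-1 = n./2.
  rewrite /odd_copy pred_nk leq_addr -addnA addn1 prednK // -mulSnr modnMl.
  by rewrite /cyc.
have star0 : odd_star 0 = 0 by rewrite /odd_star copy0 eqxx div0n.
have star1 : odd_star (n * k).-1 = k.-1.
  rewrite /odd_star copy1 eqxx pred_nk.
  by rewrite divnMDl // divn_small ?prednK // addn0.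
rewrite !vertex1 ?copy_lt // !vertex2 ?star0 ?star1 ?ltn_predL //.
rewrite copy0 copy1 /depth !eqxx /lev ltnn subnn.
by have -> : (0 == k.-1) = false by lia.
Qed.

End Orderings.

(** * The radio number of the firecracker tree *)

(** Doubling and moving 3 to the left keep the formula free of division and subtraction in [nat]. *)
Lemma radio_number_firecracker n k : 3 <= n -> 3 <= k ->
  2 * (radio_number (@firecracker n k) + 3) = (n ^ 2 + odd n) * k + 10 * n.
Proof.
move=> hn hk.
have upper : radio_number (@firecracker n k)
    + 2 * \sum_(u : 'I_n * 'I_k.-1.+1) vlev u
      <= (n * k).-1 * (n + 3 + odd n) + odd n.
  have [n_odd|n_even] := orP (orbN (odd n)).
    apply: (@firecracker_upper_bound n k hn hk (odd_seq k hn) (@odd_pos n k)).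
    - exact: odd_pos_lt.
    - exact: odd_posK.
    - by move=> t; apply: odd_links.
    - by rewrite n_odd; apply: odd_ends.
  apply: (@firecracker_upper_bound n k hn hk (even_seq k hn) (@even_pos n k)).
  - exact: even_pos_lt.
  - exact: even_posK.
  - exact: even_links.
  - by rewrite (negPf n_even); apply: even_ends.
have := firecracker_lower_bound hn hk; move: upper; rewrite sum_vlev //.
have := sum_lev n; have := sum_depth hk.
move: (radio_number _) (\sum_(x < _) _) (\sum_(i < _) _) => r SL SD.
have := half_eq n; move: (odd n) n./2 => o m n_eq.
have {hn}: 0 < m by case: o n_eq => /=; lia.
case: m n_eq => // m n_eq _ eqSD eqSL.
have [p def_k] : exists p, k = p.+2 by exists (k - 2); lia.
have {eqSD} -> : SD = 2 * p + 1 by lia.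
have {eqSL} -> : SL = m.+1 * m + 2 * o * m.+1 by lia.
have -> : (n * k).-1 = n * p + n.*2.-1 by rewrite def_k; lia.
by rewrite def_k n_eq; case: o n_eq => /= _; lia.
Qed.

Import GRing.Theory.
Local Open Scope ring_scope.

Theorem theorem4p2 (n k : nat) (hn : (3 <= n)%N) (hk : (3 <= k)%N) :
  (radio_number (@firecracker n k))%:R =
    (n%:R ^+ 2 + (if odd n then 1 else 0)) * k%:R / 2 + 5 * n%:R - 3 :> rat.
Proof.
have /(congr1 (fun m => m%:R : rat)) := radio_number_firecracker hn hk.
rewrite !natrM !natrD !natrM natrD natrX.
have -> : (odd n)%:R = (if odd n then 1 else 0) :> rat by case: (odd n).
move: (radio_number _)%:R (if _ then _ else _) => r o eq_r.
have -> : r = (2 * (r + 3)) / 2 - 3 :> rat by field.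
by rewrite eq_r; field.
Qed.
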